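(* Let $R=\bigoplus_{d\ge 0}R_d$ be a finitely generated $\mathbb{N}$-graded domain, let $\mathfrak{m}=\bigoplus_{d>0}R_d$, and suppose that $R/\mathfrak{m}\cong R_0$ is an infinite field. Let $\mathcal{I}=\{I_{[k]}\}_{k\ge0}$ be a Noetherian graded filtration of $R$. Then $\mathrm{v}(I_{[k]})$ is a quasi-linear function in $k$ for all $k\gg0$.
   Context: A graded filtration of $R$ is a family $\mathcal{I}=\{I_{[k]}\}_{k\ge0}$ of homogeneous ideals of $R$ such that (i) $I_{[0]}=R$, (ii) $I_{[k+1]}\subseteq I_{[k]}$ for all $k\ge0$, and (iii) $I_{[k]}I_{[\ell]}\subseteq I_{[k+\ell]}$ for all $k,\ell\ge0$. It is called Noetherian if its Rees algebra $\mathcal{R}(\mathcal{I})=\bigoplus_{k\ge0}I_{[k]}$ is Noetherian. For an ideal $I\subset R$, $\mathrm{Ass}(I)$ denotes the set of associated primes of $R/I$. For a homogeneous ideal $I\subset R$ and $\mathfrak{p}\in\mathrm{Ass}(I)$, the $\mathrm{v}_{\mathfrak p}$-number $\mathrm{v}_{\mathfrak p}(I)$ is the least degree of a homogeneous element $f\in R$ with $(I:f)=\mathfrak{p}$, and the $\mathrm{v}$-number of $I$ is $\mathrm{v}(I)=\min_{\mathfrak{p}\in\mathrm{Ass}(I)}\mathrm{v}_{\mathfrak p}(I)$. A numerical function $f:\mathbb{Z}_{\ge0}\to\mathbb{Z}_{\ge0}$ is called quasi-linear (of period $c$) if there exist a positive integer $c$ and linear functions $f_i(k)=a_ik+b_i$,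 $i=0,\dots,c-1$, such that $f(k)=f_i(k)$ if $k\equiv i \pmod c$. Being quasi-linear for all $k\gg0$ means that these equalities hold for all sufficiently large $k$. *)

(* Defs.v *)
From mathcomp Require Import all_boot all_order all_algebra.
From mathcomp Require Import all_classical.

Set Implicit Arguments.
Unset Strict Implicit.
Unset Printing Implicit Defensive.

Import GRing.Theory.

Local Open Scope ring_scope.
Local Open Scope classical_set_scope.

Section Rings.
Variable A : comNzRingType.
Implicit Types (S J : set A) (s : seq A).

(* J is an ideal of the subring S of A. The unit ideal J = S is allowed, unlike
   in idealr_closed of ring_quotient. *)
Definition ideal_of S J : Prop :=
  [/\ J `<=` S, GRing.zmod_closed [in J]
    & forall a x, S a -> J x -> J (a * x)].

Definition ideal J : Prop := ideal_of setT J.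

Definition ideal_span S s : set A :=
  [set x | exists c : nat -> A,
     (forall i, S (c i)) /\ x = \sum_(i < size s) c i * s`_i].

Definition noetherian_subring S : Prop :=
  GRing.subring_closed [in S] /\
  (forall J, ideal_of S J -> exists s, J = ideal_span S s).

Definition prime_ideal J : Prop :=
  idealr_closed [in J] /\ prime_idealr_closed [in J].

Definition colon J (f : A) : set A := [set g | J (g * f)].

(* The annihilator in A / J of the class of f is (J : f). *)
Definition Ass J : set (set A) :=
  [set P | prime_ideal P /\ exists f, P = colon J f].

Definition is_subfield S : Prop :=
  GRing.subring_closed [in S] /\
  (forall x, S x -> x != 0 -> exists2 y, S y & x * y = 1).

Definition fg_algebra_over S : Prop :=
  exists s, forall T : set A,
    GRing.subring_closed [in T] -> S `<=` T -> (forall x, x \in s -> T x) ->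
    T = setT.

End Rings.

(* The least element of E; 0 when E is empty. *)
Definition least (E : set nat) : nat :=
  xget 0%N [set n | E n /\ forall m, E m -> (n <= m)%N].

Section Graded.
Variable R : comNzRingType.
Implicit Types (G : nat -> set R) (I : nat -> set R) (J P : set R).

Record grading G : Prop := Grading {
  grading_zmod : forall d, GRing.zmod_closed [in G d];
  grading_one : G 0%N 1;
  grading_mul : forall i j x y, G i x -> G j y -> G (i + j)%N (x * y);
  grading_span : forall x, exists n (f : nat -> R),
    (forall d, G d (f d)) /\ x = \sum_(d < n) f d;
  grading_indep : forall n (f : nat -> R), (forall d, G d (f d)) ->
    \sum_(d < n) f d = 0 -> forall d, (d < n)%N -> f d = 0 }.

Definition homogeneous_ideal G J : Prop :=
  ideal J /\
  (forall n (f : nat -> R), (forall d, G d (f d)) ->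
     J (\sum_(d < n) f d) -> forall d, (d < n)%N -> J (f d)).

Record graded_filtration G I : Prop := GradedFiltration {
  filtration_homogeneous : forall k, homogeneous_ideal G (I k);
  filtration0 : I 0%N = setT;
  filtrationS : forall k, I k.+1 `<=` I k;
  filtrationM : forall k l x y, I k x -> I l y -> I (k + l)%N (x * y) }.

(* The direct sum of the I k, as the subring of R[X] of the polynomials whose
   coefficient of 'X^k lies in I k. *)
Definition rees I : set {poly R} := [set p | forall k, I k p`_k].

Definition noetherian_filtration I : Prop := noetherian_subring (rees I).

Definition v_at G J P : nat :=
  least [set d | exists2 f, G d f & colon J f = P].

(* For J = setT, which has no associated prime, this is 0 by the convention of
   least. If I k = setT for some k > 0 then every I k is setT, so on a
   filtration the convention matters only at k = 0 or in that trivial case. *)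
Definition v_number G J : nat := least (v_at G J @` Ass J).

End Graded.

(* The coefficients are rational: on k = i %[mod c] integrality of the values
   only forces c * a i to be an integer. *)
Definition eventually_quasi_linear (f : nat -> nat) : Prop :=
  exists c : nat, (0 < c)%N /\
  exists a b : 'I_c -> rat, exists N : nat,
    forall (k : nat) (i : 'I_c), (N <= k)%N -> k = i %[mod c] ->
      (f k)%:R = a i * k%:R + b i.

(* Main.v *)
Require Import Defs.
From mathcomp Require Import all_boot all_order all_algebra.
From mathcomp Require Import all_classical.
From mathcomp Require Import zify ring.

(** Write [R_d] for [G d] and [I_k] for [I k]. An associated prime of a
homogeneous ideal is the colon ideal of a homogeneous element, so [v(I_k)] is
the least degree of a homogeneous [f] with [I_k : f] prime ([v_numberE]).

Choose a nonzero homogeneous [x] in [I_1]. If [P = I_k : f] is prime then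
[x ^ k] lies in [I_k], hence in [P], so [P] contains [x]. Fix such a [P]. The
homogeneous [f] with [I_k : f = P] are the homogeneous elements of [A_k] that
are not in [B_k], where [A_k = (I_k : P)] and [B_k] consists of the [f] in [A_k]
with [s * f] in [I_k] for some [s] outside [P]. The direct sums [A] and [B] of
the [A_k] and [B_k] are bigraded modules over the Rees algebra. As [R] is a
domain and [x * A_k] is contained in [I_k], multiplication by [x] embeds [A]
into the Rees algebra, so [A] is Noetherian ([noetherian_mul]). For the same
reason the direct sum [N] of the [(I_k : x)] is Noetherian. Every [P] that
occurs for some [k] is associated to the quotient of [N] by the Rees algebra,
so only finitely many [P] occur ([finite_associated]).

It remains to see that the initial degree of [A_k / B_k] is eventually linear
in [k] along every class modulo some period ([quasi_arith_subquotient]); a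
finite minimum of such functions is again of this kind. A finite filtration
reduces the claim to shifts of quotients of the Rees algebra by bigraded primes
([devissage]). In such a quotient products of nonzero elements are nonzero, so
its bidegrees are exactly what one gets from those of the elements with [k = 0]
by repeatedly adding bidegrees of nonzero generators. Among these generators
take one with the least ratio of degree to filtration index, say of bidegree
[(c, d)]. The initial degree grows by at most [d] when [k] grows by [c], and it
stays above the line of slope [d / c], so the growth is eventually exactly [d]
([quasi_arith_knapsack]).

If there is no such [x], then [I_k = 0] for all [k > 0] and [v(I_k)] is
constant there. *)

Set Implicit Arguments.
Unset Strict Implicit.
Unset Printing Implicit Defensive.

Import GRing.Theory Num.Theory Order.TTheory.

Local Open Scope ring_scope.
Local Open Scope classical_set_scope.

(** * Sets of numbers with eventually linear least elements *)

Definition is_least (E : set nat) (n : nat) : Prop :=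
  E n /\ forall m, E m -> (n <= m)%N.

Lemma is_least_exists (E : set nat) n : E n -> exists m, is_least E m.
Proof.
elim/ltn_ind: n => n IH En.
have [[m Em mn]|h] := pselect (exists2 m, E m & (m < n)%N); first exact: IH mn Em.
by exists n; split=> // m Em; rewrite leqNgt; apply/negP => mn; apply: h; exists m.
Qed.

Lemma least_eq (E : set nat) n : is_least E n -> least E = n.
Proof.
move=> [En nmin]; apply: xget_unique => // m [Em mmin].
by apply/eqP; rewrite eqn_leq mmin // nmin.
Qed.

Lemma least0 : least set0 = 0%N.
Proof. by apply: xgetPN => m []. Qed.

(** The empty alternative stands for the constant value infinity: a module may
vanish along a whole residue class. *)
Definition eventually_arith (U : nat -> set nat) : Prop :=
  exists N, (forall j, U (N + j)%N = set0) \/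
    exists q s, forall j, is_least (U (N + j)%N) (q + s * j)%N.

Lemma eventually_arith_shift N U :
  eventually_arith (fun j => U (N + j)%N) -> eventually_arith U.
Proof.
move=> [M [h|[q [s h]]]]; exists (N + M)%N.
  by left=> j; rewrite -addnA h.
by right; exists q, s => j; rewrite -addnA; apply: h.
Qed.

Lemma eventually_arith_sub i c U : (0 < c)%N ->
  eventually_arith U -> eventually_arith (fun j => U (i + c * j)%N).
Proof.
move=> c0 [N h]; exists N.
have E j : (i + c * (N + j) = N + (i + c.-1 * N + c * j))%N.
  by case: c c0 => // c _ /=; lia.
case: h => [h|[q [s h]]]; first by left=> j; rewrite E h.
right; exists (q + s * (i + c.-1 * N))%N, (s * c)%N => j; rewrite E.
by have := h (i + c.-1 * N + c * j)%N; congr (is_least (U _) _); nia.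
Qed.

(** Of two linear functions the one with the smaller slope, or on equal slopes
the smaller constant term, is eventually the minimum. *)
Lemma eventually_arith_union U V : eventually_arith U -> eventually_arith V ->
  eventually_arith (fun j => U j `|` V j).
Proof.
(* Where U1 has the smaller terms, its progression is that of the union. *)
have win (U1 U2 : nat -> set nat) N q s :
    (forall j, is_least (U1 (N + j)%N) (q + s * j)%N) ->
    (forall j m, U2 (N + j)%N m -> (q + s * j <= m)%N) ->
    eventually_arith (fun j => U1 j `|` U2 j).
  move=> h1 h2; exists N; right; exists q, s => j.
  have [h3 h4] := h1 j; split; first by left.
  by move=> m [/h4|/h2].
have winS N q s N' q' s' U1 U2 : (s < s' \/ s = s' /\ q + s * N' <= q' + s' * N)%N ->
    (forall j, is_least (U1 (N + j)%N) (q + s * j)%N) ->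
    (forall j, is_least (U2 (N' + j)%N) (q' + s' * j)%N) ->
    eventually_arith (fun j => U1 j `|` U2 j).
  move=> hs h1 h2; pose T := (q + s * N' + s' * N)%N.
  apply: (win _ _ (N + (N' + T))%N (q + s * (N' + T))%N s) => j.
    by have := h1 (N' + T + j)%N; congr (is_least (U1 _) _); nia.
  move=> m.
  have -> : (N + (N' + T) + j = N' + (N + T + j))%N by lia.
  move/(proj2 (h2 _)); apply: leq_trans.
  case: hs => [hs|[<- hs]]; last by nia.
  have -> : (s' = s + (s' - s).-1.+1)%N by lia.
  move: (s' - s).-1 => t; rewrite /T; nia.
move=> [N [hU|[q [s hU]]]] [N' [hV|[q' [s' hV]]]].
- exists (N + N')%N; left=> j.
  by rewrite -addnA hU addnCA hV setU0.
- apply: (@eventually_arith_shift (N + N')); exists 0%N; right.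
  exists (q' + s' * N)%N, s' => j; rewrite add0n -addnA hU set0U.
  by have := hV (N + j)%N; congr (is_least (V _) _); nia.
- apply: (@eventually_arith_shift (N + N')); exists 0%N; right.
  exists (q + s * N')%N, s => j; rewrite add0n -addnA [in V _]addnCA hV setU0.
  by have := hU (N' + j)%N; congr (is_least (U _) _); nia.
- have [h|[h|h]] : (s < s' \/ s = s' /\ q + s * N' <= q' + s' * N)%N \/
    ((s' < s \/ s' = s /\ q' + s' * N <= q + s * N')%N \/ False) by lia.
  + exact: winS h hU hV.
  + rewrite (_ : (fun _ => _) = (fun j => V j `|` U j)); last first.
      by apply/funext => j; rewrite setUC.
    exact: winS h hV hU.
  + by [].
Qed.

(** Asking for every start [k], and not only for [k < c], makes the property
invariant under shifts of the index. *)
Definition quasi_arith (W : nat -> set nat) : Prop :=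
  exists2 c, (0 < c)%N & forall k, eventually_arith (fun j => W (k + c * j)%N).

Lemma quasi_arith_empty : quasi_arith (fun _ => set0).
Proof. by exists 1%N => // k; exists 0%N; left. Qed.

Lemma quasi_arith_union V W : quasi_arith V -> quasi_arith W ->
  quasi_arith (fun k => V k `|` W k).
Proof.
move=> [c c0 hV] [c' c'0 hW]; exists (c * c')%N => [|k]; first by rewrite muln_gt0 c0.
apply: eventually_arith_union.
  rewrite (_ : (fun _ => _) = fun j => V (k + c * (0 + c' * j))%N).
    exact: (eventually_arith_sub 0 c'0 (hV k)).
  by apply/funext => j; rewrite add0n mulnA.
rewrite (_ : (fun _ => _) = fun j => W (k + c' * (0 + c * j))%N).
  exact: (eventually_arith_sub 0 c0 (hW k)).
by apply/funext => j; rewrite add0n mulnCA mulnA.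
Qed.

Lemma quasi_arith_bigcup (T : choiceType) (s : seq T) (W : T -> nat -> set nat) :
  (forall t, t \in s -> quasi_arith (W t)) ->
  quasi_arith (fun k => [set d | exists2 t, t \in s & W t k d]).
Proof.
elim: s => [|t s IH] h.
  rewrite (_ : (fun _ => _) = fun=> set0); first exact: quasi_arith_empty.
  by apply/funext => k; apply/seteqP; split=> d // [].
rewrite (_ : (fun _ => _) = fun k =>
    W t k `|` [set d | exists2 t, t \in s & W t k d]).
  apply: quasi_arith_union; first by apply: h; rewrite mem_head.
  by apply: IH => u us; apply: h; rewrite inE us orbT.
apply/funext => k; apply/seteqP; split=> d.
  by move=> [u]; rewrite inE => /orP[/eqP->|us]; [left|right; exists u].
by move=> [h1|[u us h1]]; [exists t; rewrite ?mem_head|exists u; rewrite // inE us orbT].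
Qed.

Lemma quasi_arith_shift l e (V W : nat -> set nat) : quasi_arith V ->
  (forall k d, W (l + k)%N d <-> exists2 d', V k d' & d = (e + d')%N) ->
  quasi_arith W.
Proof.
move=> [c c0 hV] VW; exists c => // k.
apply: (@eventually_arith_shift l).
have E j : (k + c * (l + j) = l + (k + c.-1 * l + c * j))%N.
  by case: c c0 {hV} => // c _ /=; lia.
have [N h] := hV (k + c.-1 * l)%N; exists N; case: h => [h|[q [s h]]].
  left=> j; apply/seteqP; split=> d //; rewrite E => /VW [d' + _].
  by rewrite h.
right; exists (e + q)%N, s => j; rewrite E; have [h1 h2] := h j.
split; first by apply/VW; exists (q + s * j)%N; rewrite // addnA.
by move=> m /VW [d' /h2 + ->]; lia.
Qed.

Lemma best_ratio (T : eqType) (s : seq T) (c d : T -> nat) (P : set T) :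
  (forall t, t \in s -> P t -> 0 < c t)%N ->
  (exists2 t, t \in s & P t) ->
  exists t, [/\ t \in s, P t &
    forall u, u \in s -> P u -> (d t * c u <= d u * c t)%N].
Proof.
elim: s => [|t s IH] c0 [u] //.
have [h|h] := pselect (exists2 t, t \in s & P t); last first.
  rewrite inE => /orP[/eqP-> Pt|us Pu]; last by case: h; exists u.
  exists t; split; rewrite ?mem_head // => v; rewrite inE => /orP[/eqP->|vs Pv] //.
  by case: h; exists v.
move=> _ _.
have [v [vs Pv vmin]] := IH (fun u us => c0 u (@mem_behead _ (t :: s) u us)) h.
have [[Pt lt]|nt] := pselect (P t /\ (d t * c v <= d v * c t)%N).
  exists t; split; rewrite ?mem_head // => w; rewrite inE => /orP[/eqP->|ws Pw] //.
  have cv : (0 < c v)%N by apply: c0; rewrite // inE vs orbT.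
  by have := vmin w ws Pw; nia.
exists v; split; rewrite // ?inE ?vs ?orbT // => w; rewrite inE => /orP[/eqP-> Pt|ws Pw].
  by apply/ltnW; rewrite ltnNge; apply/negP => h1; apply: nt.
exact: vmin.
Qed.

(** The least elements of [W] solve a min-plus linear recursion with steps
[(c t, d t)], [t] in [s]. Let [t] have the least ratio [d t / c t]. Along a
class modulo [c t], each step raises the least element by at most [d t],
while every element [n] of [W k] satisfies [n >= k * d t / c t]. So the excess
over the slope [d t] is a nonincreasing sequence of natural numbers. *)
Lemma quasi_arith_knapsack (T : eqType) (s : seq T) (c d : T -> nat) (P : set T)
    (W : nat -> set nat) :
  (forall t, t \in s -> P t -> (0 < c t)%N) ->
  (forall t k n, t \in s -> P t -> W k n -> W (c t + k)%N (d t + n)%N) ->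
  (forall k n, (0 < k)%N -> W k n -> exists t, [/\ t \in s, P t &
     exists k' n', [/\ k = (c t + k')%N, n = (d t + n')%N & W k' n']]) ->
  quasi_arith W.
Proof.
move=> c0 Wadd Wsub.
have [h|h] := pselect (exists2 t, t \in s & P t); last first.
  exists 1%N => // k; exists 1%N; left=> j; apply/seteqP; split=> n //.
  rewrite mul1n => /Wsub [|t [ts Pt _]]; first by lia.
  by case: h; exists t.
have [t [ts Pt tmin]] := @best_ratio _ s c d P c0 h.
have ct := c0 t ts Pt.
have lb k : forall n, W k n -> (d t * k <= c t * n)%N.
  elim/ltn_ind: k => k IH n Wkn.
  have [->|k0] := posnP k; first by rewrite muln0.
  have [u [us Pu [k' [n' [Ek -> Wk']]]]] := Wsub k n k0 Wkn.
  have cu := c0 u us Pu.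
  have le : (d t * k' <= c t * n')%N by apply: IH => //; lia.
  by rewrite Ek !mulnDr leq_add // [leqRHS]mulnC; apply: tmin.
exists (c t) => // k.
pose U j := W (k + c t * j)%N.
have Uadd i j n : U j n -> U (i + j)%N (n + d t * i)%N.
  move=> Ujn; elim: i => [|i IH]; first by rewrite muln0 addn0.
  by have := Wadd t _ _ ts Pt IH; congr (W _ _); nia.
have [[j [n Ujn]]|hU] := pselect (exists j n, U j n); last first.
  exists 0%N; left=> j; apply/seteqP; split=> n // Ujn.
  by case: hU; exists j, n.
(* The excess of the least element of U over the slope d t can only drop, and
   it never becomes negative; its least value is the one at which it stays. *)
pose E : set nat := [set e | exists j, U j (e + d t * j)%N].
have UE i m : U i m -> (d t * i <= m)%N.
  by move=> /lb; rewrite mulnDr => h1; rewrite -(leq_pmul2l ct); nia.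
have [e [[j0 Ue] emin]] : exists e, is_least E e.
  by apply: (@is_least_exists E (n - d t * j)%N); exists j; rewrite subnK // UE.
exists j0; right; exists (e + d t * j0)%N, (d t) => i; split.
  by have := Uadd i _ _ Ue; congr (W _ _); nia.
move=> m Um; have := UE _ _ Um => h1.
have /emin : E (m - d t * (j0 + i))%N by exists (j0 + i)%N; rewrite subnK.
by lia.
Qed.

Lemma quasi_arith_eventually_quasi_linear (f : nat -> nat) (L : nat -> set nat) :
  quasi_arith L -> (forall k, f k = least (L k)) -> eventually_quasi_linear f.
Proof.
move=> [c c0 hL] fL; exists c; split=> //.
have cn0 : c%:R != 0 :> rat by rewrite pnatr_eq0 -lt0n.
have /choice [h hh] : forall i : 'I_c, exists abN : rat * rat * nat,
    forall k, (abN.2 <= k)%N -> k = i %[mod c] ->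
      (f k)%:R = abN.1.1 * k%:R + abN.1.2.
  move=> i; have [N h] := hL i.
  have ki k : (i + c * N <= k)%N -> k = i %[mod c] ->
      exists j, k = (i + c * (N + j))%N.
    rewrite (modn_small (ltn_ord i)) => le ki.
    exists (k %/ c - N)%N; rewrite {1}(divn_eq k c) ki mulnC subnKC; first by rewrite addnC.
    by rewrite leq_divRL // mulnC; apply: leq_trans le; rewrite leq_addl.
  case: h => [h|[q [s h]]].
    exists (0, 0, (i + c * N)%N) => k /= /ki{}ki /ki[j ->].
    by rewrite fL h least0 mul0r addr0.
  exists (s%:R / c%:R, q%:R - s%:R / c%:R * (i + c * N)%:R, (i + c * N)%N).
  move=> k /= /ki{}ki /ki[j ->].
  rewrite fL (least_eq (h j)) !(natrD, natrM).
  by field.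
exists (fun i => (h i).1.1), (fun i => (h i).1.2), (\max_(i < c) (h i).2)%N.
move=> k i le; apply: hh; apply: leq_trans le.
exact: (leq_bigmax (F := fun i : 'I_c => (h i).2)).
Qed.

(** * Ideals as classical sets *)

Lemma zmod_closed_setP (R : comNzRingType) (J : set R) :
  GRing.zmod_closed [in J] <-> J 0 /\ forall x y, J x -> J y -> J (x - y).
Proof.
split=> [[h0 hB]|[h0 hB]].
  split=> [|x y Jx Jy]; first exact: set_mem.
  by apply: set_mem; apply: hB; apply: mem_set.
split; first exact: mem_set.
by move=> x y /set_mem Jx /set_mem Jy; apply/mem_set/hB.
Qed.

Section Ideals.
Variables (R : comNzRingType).
Implicit Types (J P : set R).

Lemma ideal0 J : ideal J -> J 0.
Proof. by move=> [_ /zmod_closed_setP[]]. Qed.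

Lemma idealB J x y : ideal J -> J x -> J y -> J (x - y).
Proof. by move=> [_ /zmod_closed_setP[_ h] _]; apply: h. Qed.

Lemma idealD J x y : ideal J -> J x -> J y -> J (x + y).
Proof.
move=> iJ Jx Jy; rewrite -[y]opprK -[- y]sub0r.
by apply: idealB => //; apply: idealB => //; apply: ideal0.
Qed.

Lemma idealM J a x : ideal J -> J x -> J (a * x).
Proof. by move=> [_ _ h]; apply: h. Qed.

Lemma ideal_sum J (T : Type) (s : seq T) (Q : pred T) (f : T -> R) : ideal J ->
  (forall t, Q t -> J (f t)) -> J (\sum_(t <- s | Q t) f t).
Proof.
move=> iJ h; elim/big_rec: _ => [|t y Qt Jy]; first exact: ideal0.
by apply: idealD => //; apply: h.
Qed.

Lemma prime_ideal1 P : prime_ideal P -> ~ P 1.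
Proof. by move=> [[_ /negP h _] _] P1; apply: h; apply: mem_set. Qed.

Lemma prime_idealM P x y : prime_ideal P -> P (x * y) -> P x \/ P y.
Proof.
by move=> [_ h] /mem_set /h /orP[] /set_mem; [left|right].
Qed.

Lemma prime_idealX P x n : prime_ideal P -> P (x ^+ n) -> P x.
Proof.
move=> pP; elim: n => [/(prime_ideal1 pP)|n IH] //.
by rewrite exprS => /(prime_idealM pP)[|/IH].
Qed.

End Ideals.

(** * Homogeneous components *)

Section Components.
Variables (R : comNzRingType) (G : nat -> set R) (gradG : grading G).

Lemma homog0 d : G d 0.
Proof. by have /zmod_closed_setP[] := grading_zmod gradG d. Qed.

Lemma homogB d x y : G d x -> G d y -> G d (x - y).
Proof. by have /zmod_closed_setP[_ h] := grading_zmod gradG d; apply: h. Qed.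

Lemma homogD d x y : G d x -> G d y -> G d (x + y).
Proof.
move=> Gx Gy; rewrite -[y]opprK -[- y]sub0r.
by apply: homogB => //; apply: homogB => //; apply: homog0.
Qed.

Lemma sum_ord_widen (f : nat -> R) n m : (n <= m)%N ->
  (forall d, (n <= d)%N -> f d = 0) -> \sum_(d < m) f d = \sum_(d < n) f d.
Proof.
move=> nm f0; rewrite -!(big_mkord xpredT f) (big_cat_nat (n := n)) //=.
by rewrite addrC big_nat_cond big1 ?add0r // => d /andP[/andP[/f0]].
Qed.

Lemma hcomp_exists x : exists f : nat -> R, (forall d, G d (f d)) /\
  exists n, (forall d, (n <= d)%N -> f d = 0) /\ x = \sum_(d < n) f d.
Proof.
have [n [f [Gf ->]]] := grading_span gradG x.
exists (fun d => if (d < n)%N then f d else 0); split.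
  by move=> d; case: ifP => // _; apply: homog0.
exists n; split=> [d|]; first by rewrite leqNgt => /negbTE->.
by apply: eq_bigr => d _; rewrite ltn_ord.
Qed.

Definition hcomp (x : R) : nat -> R := sval (cid (hcomp_exists x)).

Lemma hcompG x d : G d (hcomp x d).
Proof. by rewrite /hcomp; case: cid => f [/= h _]. Qed.

Lemma hcomp_finite x : exists n, forall d, (n <= d)%N -> hcomp x d = 0.
Proof. by rewrite /hcomp; case: cid => f [/= _ [n [h _]]]; exists n. Qed.

Lemma hcomp_unique x n (f : nat -> R) d : (forall d, G d (f d)) ->
  (forall d, (n <= d)%N -> f d = 0) -> x = \sum_(d < n) f d -> hcomp x d = f d.
Proof.
move=> Gf f0 xf; have Gh := hcompG x; move: Gh; rewrite /hcomp.
case: cid => g [/= _ [m [g0 xg]]] Gg.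
pose M := (n + m + d.+1)%N; apply/eqP; rewrite -subr_eq0; apply/eqP.
apply: (@grading_indep _ _ gradG M (fun d => g d - f d)).
- by move=> e; apply: homogB.
- have [nM mM] : (n <= M)%N /\ (m <= M)%N by rewrite /M; lia.
  by rewrite sumrB (sum_ord_widen mM g0) (sum_ord_widen nM f0) -xg -xf subrr.
- by rewrite /M; lia.
Qed.

Lemma sum_hcomp x n : (forall d, (n <= d)%N -> hcomp x d = 0) ->
  x = \sum_(d < n) hcomp x d.
Proof.
rewrite /hcomp; case: cid => f /= [_ [m [f0 xf]]] f0'.
rewrite {1}xf -(@sum_ord_widen f m (n + m)) ?leq_addl //.
by rewrite (@sum_ord_widen f n (n + m)) ?leq_addr.
Qed.

Lemma hcompE x : exists n, forall m, (n <= m)%N -> x = \sum_(d < m) hcomp x d.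
Proof.
have [n hn] := hcomp_finite x; exists n => m nm.
by apply: sum_hcomp => d md; apply/hn/(leq_trans nm).
Qed.

Lemma hcomp_homog x d e : G d x -> hcomp x e = if e == d then x else 0.
Proof.
move=> Gx; apply: (@hcomp_unique _ d.+1 (fun e => if e == d then x else 0)).
- by move=> i; case: eqP => [->|_] //; apply: homog0.
- by move=> i; case: eqP => // ->; rewrite ltnn.
- rewrite -big_mkcond (big_pred1 ord_max) // => i; exact: val_eqE.
Qed.

Lemma hcomp_id x d : G d x -> hcomp x d = x.
Proof. by move=> Gx; rewrite (hcomp_homog _ Gx) eqxx. Qed.

Lemma hcomp0 d : hcomp 0 d = 0.
Proof. exact/hcomp_id/homog0. Qed.

Lemma hcompD x y d : hcomp (x + y) d = hcomp x d + hcomp y d.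
Proof.
have [n hn] := hcomp_finite x; have [m hm] := hcomp_finite y.
apply: (@hcomp_unique _ (n + m) (fun d => hcomp x d + hcomp y d)).
- by move=> e; apply: homogD; apply: hcompG.
- by move=> e le; rewrite hn ?hm ?addr0 //; lia.
- rewrite big_split /=; congr (_ + _); apply: sum_hcomp => e le.
    by apply: hn; lia.
  by apply: hm; lia.
Qed.

Lemma hcompB x y d : hcomp (x - y) d = hcomp x d - hcomp y d.
Proof. by apply/eqP; rewrite eq_sym subr_eq -hcompD subrK. Qed.

Lemma hcomp_sum (T : Type) (s : seq T) (Q : pred T) (f : T -> R) d :
  hcomp (\sum_(t <- s | Q t) f t) d = \sum_(t <- s | Q t) hcomp (f t) d.
Proof.
by apply: (big_morph (hcomp^~ d)) => [x y|]; [apply: hcompD|apply: hcomp0].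
Qed.

Lemma hcompMr x y d e : G d y -> hcomp (x * y) (e + d) = hcomp x e * y.
Proof.
move=> Gy; have [n /(_ (n + e.+1)%N (leq_addr _ _)) {1}->] := hcompE x.
rewrite mulr_suml hcomp_sum (bigD1 (Ordinal (leq_addl n e.+1))) //=.
rewrite big1 ?addr0.
  by rewrite hcomp_id //; apply: (grading_mul gradG) => //; apply: hcompG.
move=> i; rewrite -val_eqE /= => ie.
rewrite (hcomp_homog _ (grading_mul gradG (hcompG x i) Gy)).
by rewrite eqn_add2r eq_sym (negbTE ie).
Qed.

Lemma hcompM_top x y n m : (forall d, (n < d)%N -> hcomp x d = 0) ->
  (forall d, (m < d)%N -> hcomp y d = 0) ->
  hcomp (x * y) (n + m) = hcomp x n * hcomp y m.
Proof.
move=> xn ym; rewrite (@sum_hcomp y m.+1) //= mulr_sumr hcomp_sum.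
rewrite -(sum_hcomp ym) big_ord_recr /= hcompMr; last exact: hcompG.
rewrite big1 ?add0r // => i _; have im := ltn_ord i.
have -> : (n + m = n + (m - i) + i)%N by lia.
rewrite hcompMr; last exact: hcompG.
by rewrite xn ?mul0r //; lia.
Qed.

Lemma homogeneous_hcomp J x d : homogeneous_ideal G J -> J x -> J (hcomp x d).
Proof.
move=> [_ hJ] Jx; have [n /(_ (n + d.+1)%N (leq_addr _ _)) xE] := hcompE x.
by apply: (hJ (n + d.+1)%N _ (hcompG x)); rewrite -?xE // leq_addl.
Qed.

Lemma ideal_hcomp J x : ideal J -> (forall d, J (hcomp x d)) -> J x.
Proof.
move=> iJ h; have [n /(_ n (leqnn n)) ->] := hcompE x.
by apply: ideal_sum.
Qed.

(** * Associated primes of homogeneous ideals *)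

Variables (J P : set R) (f : R).
Hypotheses (homJ : homogeneous_ideal G J) (primeP : prime_ideal P).
Hypothesis (PJf : P = colon J f).

Let idealJ : ideal J. Proof. by case: homJ. Qed.

(** If [r] kills [y] modulo [J], a power of the top component [r_n] of [r]
does too: [r_n * y_N] is the top component of [r * y], so it lies in [J], and
[r_n * y] is congruent modulo [J] to an element with one component fewer, still
killed by [r]. The homogeneous factor [h] collects the powers of [r_n] without
changing the number of components of [y]. *)
Lemma mul_top_hcomp r n N h e y : (forall d, (n < d)%N -> hcomp r d = 0) ->
  G e h -> (forall d, (N <= d)%N -> hcomp y d = 0) ->
  J (r * h * y) -> J (hcomp r n ^+ N * (h * y)).
Proof.
move=> rn; elim: N e h y => [|N IH] e h y Gh yN Jrhy.
  by rewrite (sum_hcomp yN) big_ord0 !mulr0; apply: ideal0.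
have Jtop : J (hcomp r n * h * hcomp y N).
  have := homogeneous_hcomp (n + N + e) homJ Jrhy.
  by rewrite mulrAC hcompMr // hcompM_top // mulrAC.
have Grh := grading_mul gradG (hcompG r n) Gh.
have yE : y = (y - hcomp y N) + hcomp y N by rewrite subrK.
have -> : hcomp r n ^+ N.+1 * (h * y) = hcomp r n ^+ N *
    (hcomp r n * h * (y - hcomp y N)) + hcomp r n ^+ N * (hcomp r n * h * hcomp y N).
  by rewrite exprS; ring.
apply: idealD => //; last exact: idealM.
apply: (IH _ _ _ Grh).
  move=> d; rewrite hcompB leq_eqVlt => /orP[/eqP<-|Nd].
    by rewrite (hcomp_id (hcompG y N)) subrr.
  by rewrite yN // (hcomp_homog _ (hcompG y N)) gtn_eqF // subr0.
have -> : r * (hcomp r n * h) * (y - hcomp y N) =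
    hcomp r n * (r * h * y) - r * (hcomp r n * h * hcomp y N) by ring.
by apply: idealB => //; apply: idealM.
Qed.

Lemma colon_prime_hcomp r d : P r -> P (hcomp r d).
Proof.
have [n rn] := hcomp_finite r.
elim: n r rn => [|n IH] r rn Pr; first by rewrite rn // PJf /colon /= mul0r; apply: ideal0.
have Ptop : P (hcomp r n).
  have [N fN] := hcomp_finite f.
  apply: (prime_idealX (n := N) primeP); rewrite PJf /colon /= -[f]mul1r.
  apply: (mul_top_hcomp rn (grading_one gradG) fN).
  by rewrite mulr1; move: Pr; rewrite PJf.
have : P (r - hcomp r n).
  move: Pr Ptop; rewrite PJf /colon /= mulrBl => Pr Ptop.
  exact: idealB.
move=> /IH; rewrite hcompB (hcomp_homog _ (hcompG r n)).
have [->|_ h] := eqVneq d n; first by [].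
rewrite -[hcomp r d]subr0; apply: h => e.
rewrite hcompB (hcomp_homog _ (hcompG r n)) leq_eqVlt => /orP[/eqP<-|ne].
  by rewrite eqxx subrr.
by rewrite gtn_eqF // subr0 rn.
Qed.

(** Since [P] is homogeneous, it is the intersection of the finitely many colon
ideals of the components of [f]; a prime that is a finite intersection of
ideals equals one of them. *)
Lemma colon_prime_homog : exists d y, G d y /\ colon J y = P.
Proof.
have Psub d r : P r -> J (r * hcomp f d).
  move=> Pr; apply: ideal_hcomp => // e.
  have [le|lt] := leqP d e; last first.
    rewrite (_ : hcomp _ _ = 0); first exact: ideal0.
    have [n /(_ n (leqnn n)) ->] := hcompE r.
    rewrite mulr_suml hcomp_sum big1 // => i _.
    rewrite (hcomp_homog _ (grading_mul gradG (hcompG r i) (hcompG f d))).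
    by rewrite ltn_eqF // ltn_addl.
  rewrite -(subnK le) hcompMr; last exact: hcompG.
  have : P (hcomp r (e - d)) by apply: colon_prime_hcomp.
  rewrite PJf /colon /= => /(homogeneous_hcomp (d + (e - d)) homJ).
  by rewrite [X in hcomp X]mulrC hcompMr 1?mulrC //; apply: hcompG.
have [[d hd]|h] := pselect (exists d, colon J (hcomp f d) `<=` P).
  exists d, (hcomp f d); split; first exact: hcompG.
  by apply/seteqP; split=> // r; apply: Psub.
have /choice[s hs] : forall d, exists s, J (s * hcomp f d) /\ ~ P s.
  move=> d; apply: contrapT => nd; apply: h; exists d => r Jr.
  by apply: contrapT => nP; apply: nd; exists r.
have [n /(_ n (leqnn n)) fE] := hcompE f.
suff nP : ~ P (\prod_(d < n) s d).
  case: nP; rewrite PJf /colon /= fE mulr_sumr; apply: ideal_sum => // d _.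
  rewrite (bigD1 d) //= mulrAC mulrC; apply: idealM => //.
  by have [] := hs d.
apply: (big_ind (fun y => ~ P y)); first exact: prime_ideal1 primeP.
  by move=> y z Py Pz /(prime_idealM primeP)[].
by move=> d _; have [] := hs d.
Qed.

End Components.

(** By [colon_prime_homog] the set of degrees defining each [v_at] is nonempty,
so its default value at the empty set never enters. *)
Lemma v_numberE (R : comNzRingType) (G : nat -> set R) (J : set R) :
  grading G -> homogeneous_ideal G J ->
  v_number G J = least [set d | exists2 f, G d f & prime_ideal (colon J f)].
Proof.
move=> gradG homJ; set L := [set d | _].
pose E P := [set d | exists2 f, G d f & colon J f = P].
have EL P d : prime_ideal P -> E P d -> L d.
  by move=> pP [f Gf fP]; exists f; rewrite ?fP.
have AssE P : Ass J P -> exists n, is_least (E P) n.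
  move=> [pP [f /(colon_prime_homog gradG homJ pP)[d [y [Gy Jy]]]]].
  by apply: (@is_least_exists (E P) d); exists y.
have [[d Ld]|L0] := pselect (exists d, L d).
  have [n [Ln nmin]] := is_least_exists Ld.
  rewrite (@least_eq L n) //; apply: least_eq; split.
    have [f Gf pf] := Ln.
    exists (colon J f); first by split=> //; exists f.
    apply: least_eq; split; first by exists f.
    by move=> m /(EL _ _ pf); apply: nmin.
  move=> _ [P AP <-]; have [m mE] := AssE P AP.
  have [pP _] := AP; have [Em _] := mE.
  by rewrite /v_at (least_eq mE); apply: nmin; apply: EL pP Em.
have -> : L = set0 by apply/seteqP; split=> // d Ld; case: L0; exists d.
rewrite /v_number; congr least; apply/seteqP; split=> // t [P AP _].
have [m [Em _]] := AssE P AP; have [pP _] := AP.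
by case: L0; exists m; apply: EL pP Em.
Qed.

(** * Bigraded modules over the Rees algebra *)

Section Modules.
Variables (R : comNzRingType) (G : nat -> set R) (I : nat -> set R).

(** The part of index [k] and degree [d] of a bigraded module is a subset of
[R]; it stands for the polynomials [f *: 'X^k] with [f] in this subset. Containment in
[I k] is not imposed, so that colon modules such as the sum of the [(I_k : x)]
are covered. *)
Definition bifamily := nat -> nat -> set R.
Implicit Types (A B C D : bifamily).

Definition subfamily A B : Prop := forall k d, A k d `<=` B k d.

Definition rees_family : bifamily := fun k d => I k `&` G d.

Record rees_module C : Prop := ReesModule {
  module0 : forall k d, C k d 0;
  moduleD : forall k d f g, C k d f -> C k d g -> C k d (f + g);
  moduleM : forall l e k d a f, rees_family l e a -> C k d f ->
    C (l + k)%N (e + d)%N (a * f) }.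

(** Generation is expressed by minimality among modules, which spares explicit
linear combinations of bihomogeneous elements. *)
Definition finitely_generated A : Prop :=
  exists s : seq (nat * nat * R), (forall t, t \in s -> A t.1.1 t.1.2 t.2) /\
    forall C, rees_module C -> (forall t, t \in s -> C t.1.1 t.1.2 t.2) ->
      subfamily A C.

Definition noetherian A : Prop :=
  forall C, rees_module C -> subfamily C A -> finitely_generated C.

(** The union of a strictly increasing chain of submodules would be finitely
generated, hence equal to one of its terms. *)
Lemma noetherian_max A (S : set bifamily) : noetherian A ->
  (forall C, S C -> rees_module C /\ subfamily C A) -> (exists C, S C) ->
  exists2 C, S C & forall C', S C' -> subfamily C C' -> subfamily C' C.
Proof.
move=> nA SA [C0 SC0]; apply: contrapT => nmax.
have /choice[g hg] : forall C, exists C', S C ->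
    [/\ S C', subfamily C C' & ~ subfamily C' C].
  move=> C; have [SC|] := pselect (S C); last by exists C.
  apply: contrapT => h; apply: nmax; exists C => // C' SC' CC'.
  by apply: contrapT => C'C; apply: h; exists C'.
pose c n := iter n g C0.
have Sc n : S (c n) by elim: n => // n /hg[].
have cS n m : (n <= m)%N -> subfamily (c n) (c m).
  move=> /subnK <-; elim: (m - n)%N => [|i IH] k d f cf //.
  by have [_ h _] := hg _ (Sc (i + n)%N); apply/h/IH.
pose W : bifamily := fun k d => [set f | exists n, c n k d f].
have mc n := (SA _ (Sc n)).1.
have mW : rees_module W.
  split=> [k d|k d f h [n cf] [m ch]|l e k d a f Ua [n cf]].
  - by exists 0%N; apply: module0 (mc 0%N) _ _.
  - exists (n + m)%N; apply: moduleD => //.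
      by apply: cS cf; rewrite leq_addr.
    by apply: cS ch; rewrite leq_addl.
  - by exists n; apply: moduleM.
have WA : subfamily W A by move=> k d f [n]; apply: (SA _ (Sc n)).2.
have [s [sW gen]] := nA W mW WA.
have [n sn] : exists n, forall t, t \in s -> c n t.1.1 t.1.2 t.2.
  elim: s sW {gen} => [|t s IH] sW; first by exists 0%N.
  have [|n hn] := IH; first by move=> u us; apply: sW; rewrite inE us orbT.
  have [m hm] := sW t (mem_head _ _).
  exists (n + m)%N => u; rewrite inE => /orP[/eqP->|/hn].
    by apply: cS hm; rewrite leq_addl.
  by apply: cS; rewrite leq_addr.
have [_ _ []] := hg _ (Sc n) => k d f cf.
by apply: (gen _ (mc n) sn); exists n.+1.
Qed.

Hypotheses (gradG : grading G) (filtI : graded_filtration G I).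

Notation hcomp := (hcomp gradG).

Let idealI k : ideal (I k).
Proof. by have [] := filtration_homogeneous filtI k. Qed.

Lemma rees_family0 e a : G e a -> rees_family 0 e a.
Proof. by move=> Ga; split=> //; rewrite (filtration0 filtI). Qed.

Lemma rees_family_module : rees_module rees_family.
Proof.
split=> [k d|k d f g [If Gf] [Ig Gg]|l e k d a f [Ia Ga] [If Gf]].
- by split; [apply: ideal0|apply: homog0].
- by split; [apply: idealD|apply: homogD gradG _ _ _ _ _].
- by split; [apply: filtrationM filtI _ _ _ _ _ _|apply: grading_mul gradG _ _ _ _ _ _].
Qed.

Section ModuleTheory.
Variables (C : bifamily) (mC : rees_module C).

Lemma moduleB k d f g : C k d f -> C k d g -> C k d (f - g).
Proof.
move=> Cf Cg; apply: moduleD => //; rewrite -mulN1r.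
apply: (@moduleM _ mC 0 0) => //; apply: rees_family0.
by rewrite -sub0r; apply: (homogB gradG); [apply: homog0|apply: grading_one].
Qed.

Lemma module_sum k d (T : Type) (s : seq T) (Q : pred T) (f : T -> R) :
  (forall t, Q t -> C k d (f t)) -> C k d (\sum_(t <- s | Q t) f t).
Proof.
move=> h; elim/big_rec: _ => [|t y Qt Cy]; first exact: module0.
by apply: moduleD => //; apply: h.
Qed.

Lemma module_homogM e k d a f : G e a -> C k d f -> C k (e + d)%N (a * f).
Proof. by move=> Ga; apply: (@moduleM _ mC 0); apply: rees_family0. Qed.

Lemma module_hcompM l a k f : I l a -> (forall d, C k d (hcomp f d)) ->
  forall d, C (l + k)%N d (hcomp (a * f) d).
Proof.
move=> Ia Cf d.
have [n /(_ n (leqnn n)) ->] := hcompE gradG a.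
have [m /(_ m (leqnn m)) ->] := hcompE gradG f.
rewrite mulr_suml hcomp_sum; apply: module_sum => i _.
rewrite mulr_sumr hcomp_sum; apply: module_sum => j _.
rewrite (hcomp_homog gradG _ (grading_mul gradG (hcompG gradG a i) (hcompG gradG f j))).
case: eqP => [->|_]; last exact: module0.
apply: moduleM => //; split; last exact: hcompG.
exact: homogeneous_hcomp (filtration_homogeneous filtI l) Ia.
Qed.

(** The ideal of the Rees algebra cut out by a bigraded module; it transfers
finite generation from ideals of [rees I] to bigraded modules. *)
Lemma rees_ideal_of_module :
  ideal_of (rees I) [set p | rees I p /\ forall k d, C k d (hcomp p`_k d)].
Proof.
split=> [p []||a p Ia [Ip Cp]] //.
  apply/zmod_closed_setP; split=> [|p q [Ip Cp] [Iq Cq]].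
    by split=> [k|k d]; rewrite coef0; [apply: ideal0|rewrite hcomp0; apply: module0].
  split=> [k|k d]; rewrite coefB; first exact: idealB.
  by rewrite hcompB; apply: moduleB.
split=> [k|k d]; rewrite coefM.
  apply: ideal_sum => // i _; rewrite -[in I k](subnKC (ltn_ord i : (i <= k)%N)).
  exact: (filtrationM filtI).
rewrite hcomp_sum; apply: module_sum => i _.
rewrite -[in C k](subnKC (ltn_ord i : (i <= k)%N)).
exact: module_hcompM.
Qed.

End ModuleTheory.

(** The bihomogeneous components of the generators of the ideal attached to
[C] generate [C]. *)
Lemma noetherian_rees : noetherian_filtration I -> noetherian rees_family.
Proof.
move=> [_ nI] C mC CU.
have [s Js] := nI _ (rees_ideal_of_module mC).
have [M hM] : exists M, forall p, p \in s -> forall k d, (M <= k)%N || (M <= d)%N ->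
    hcomp p`_k d = 0.
  elim: {Js} s => [|p s [M hM]]; first by exists 0%N.
  have [N hN] : exists N, forall k d, (k < size p)%N -> (N <= d)%N -> hcomp p`_k d = 0.
    elim: (size p) => [|n [N hN]]; first by exists 0%N.
    have [N' hN'] := hcomp_finite gradG p`_n.
    exists (N + N')%N => k d; rewrite ltnS leq_eqVlt => /orP[/eqP->|kn] Nd.
      by apply: hN'; apply: leq_trans Nd; rewrite leq_addl.
    by apply: hN kn _; apply: leq_trans Nd; rewrite leq_addr.
  exists (M + N + size p)%N => q; rewrite inE => /orP[/eqP->|qs] k d kd.
    have [le|lt] := leqP (size p) k; first by rewrite nth_default // hcomp0.
    by apply: hN => //; lia.
  by apply: hM qs _ _ _; lia.
exists [seq (kd.1, kd.2, hcomp (p : {poly R})`_kd.1 kd.2) | p <- s,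
  kd <- [seq (k, d) | k <- iota 0 M, d <- iota 0 M]].
have Ss p : p \in s -> rees I p /\ forall k d, C k d (hcomp p`_k d).
  move=> ps; suff : ideal_span (rees I) s p by rewrite -Js.
  exists (fun i => if i == index p s then 1 else 0); split=> [i k|].
    case: ifP => _; rewrite ?coef1 ?coef0; last exact: ideal0.
    by case: k => [|k]; [rewrite (filtration0 filtI)|apply: ideal0].
  have ips : (index p s < size s)%N by rewrite index_mem.
  rewrite (bigD1 (Ordinal ips)) //= eqxx mul1r nth_index // big1 ?addr0 // => i.
  by rewrite -val_eqE /= => /negbTE->; rewrite mul0r.
split=> [_ /allpairsP[[p kd] /= [/Ss[_ h] _ ->]]|D mD gen k d f Cf] //=.
have [Uf Gf] := CU _ _ _ Cf.
have Jf : ideal_span (rees I) s (f *: 'X^k).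
  rewrite -Js; split=> [j|j e]; rewrite coefZ coefXn.
    by case: eqP => [->|_]; rewrite ?mulr1 ?mulr0 //; apply: ideal0.
  case: eqP => [->|_]; rewrite ?mulr1 ?mulr0 ?hcomp0; last exact: module0.
  by rewrite (hcomp_homog gradG _ Gf); case: eqP => [->|_] //; apply: module0.
have [c [Ic fE]] := Jf.
have := rees_ideal_of_module mD; set J := [set p | _] => iJ.
have : J (f *: 'X^k).
  rewrite fE; have [_ /zmod_closed_setP[J0 JB] JM] := iJ.
  have JD p q : J p -> J q -> J (p + q).
    by move=> Jp Jq; rewrite -[q]opprK -[- q]sub0r; exact/(JB _ _ Jp)/(JB _ _ J0 Jq).
  apply: (big_ind J) => // i _.
  apply: JM => //.
  have ps := mem_nth 0 (ltn_ord i); split; first by have [] := Ss _ ps.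
  move=> l e; have [/hM ->|] := boolP ((M <= l) || (M <= e))%N => //; first exact: module0.
  rewrite negb_or -!ltnNge => /andP[lM eM].
  apply: (gen (l, e, hcomp _ e)); apply/allpairsP; exists (s`_i, (l, e)); split=> //=.
  by apply/allpairsP; exists (l, e); rewrite !mem_iota.
by move=> [_ /(_ k d)]; rewrite coefZ coefXn eqxx mulr1 hcomp_id.
Qed.

End Modules.

(** * Filtrations with prime quotients *)

Section Devissage.
Variables (R : comNzRingType) (G : nat -> set R) (I : nat -> set R).
Hypotheses (gradG : grading G) (filtI : graded_filtration G I).
Hypothesis noethI : noetherian_filtration I.

Notation hcomp := (hcomp gradG).
Notation bifamily := (bifamily R).
Notation U := (rees_family G I).
Notation rees_module := (rees_module G I).
Notation noetherian := (noetherian G I).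
Implicit Types (A B C D : bifamily).

Let mU : rees_module U := rees_family_module gradG filtI.
Let nU : noetherian U := noetherian_rees gradG filtI noethI.

(** Multiplication by [x] identifies the submodules of [A] with bigraded ideals
of the Rees algebra. *)
Lemma noetherian_mul x e A : GRing.lreg x ->
  (forall k d f, A k d f -> U k (d + e)%N (x * f)) -> noetherian A.
Proof.
move=> xreg xA C mC CA.
(* The image of D under multiplication by x; e <= d guards the truncated
   subtraction. *)
pose xM D : bifamily := fun k d => [set F | exists f, F = x * f /\
  if (e <= d)%N then D k (d - e)%N f else f = 0].
have mxM D : rees_module D -> rees_module (xM D).
  move=> mD; split=> [k d|k d F F' [f [-> Df]] [f' [-> Df']]|l a k d r F Ur [f [-> Df]]].
  - by exists 0; rewrite mulr0; split=> //; case: ifP => // _; apply: (module0 mD _ _).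
  - exists (f + f'); rewrite mulrDr; split=> //; case: ifP Df Df' => _.
      exact: (moduleD mD).
    by move=> -> ->; rewrite addr0.
  - exists (r * f); rewrite mulrCA; split=> //; case: ifP Df => [ed Df|_ ->].
      by rewrite (leq_trans ed) ?leq_addl // -addnBA //; apply: (moduleM mD Ur Df).
    by rewrite mulr0; case: ifP => // _; apply: (module0 mD _ _).
have [|s [sC gen]] := nU (mxM C mC).
  move=> k d _ [f [-> Cf]]; case: ifP Cf => [ed /CA/xA|_ ->]; first by rewrite subnK.
  by rewrite mulr0; apply: (module0 mU _ _).
have /choice[g hg] : forall t, exists f, t \in s -> t.2 = x * f /\
    if (e <= t.1.2)%N then C t.1.1 (t.1.2 - e)%N f else f = 0.
  by move=> t; have [/sC[f h]|_] := boolP (t \in s); [exists f|exists 0].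
exists [seq (t.1.1, t.1.2 - e, g t)%N | t <- s & (e <= t.1.2)%N]; split.
  move=> _ /mapP[t + ->] /=; rewrite mem_filter => /andP[et /hg[_]].
  by rewrite et.
move=> D mD sD k d f Cf.
have [||f' [/xreg ->]] := gen _ (mxM D mD) _ k (d + e)%N (x * f).
- move=> t ts; have [tE gt] := hg t ts; exists (g t); split=> //.
  case: ifP gt => // et _; apply: (sD (t.1.1, t.1.2 - e, g t)%N).
  by apply/mapP; exists t; rewrite // mem_filter et.
- by exists f; rewrite leq_addl addnK.
- by rewrite leq_addl addnK.
Qed.

(** The module generated by [B] and an element [m] of bidegree [(l, e)]. *)
Definition adjoin B l e m : bifamily := fun k d => [set f | exists h,
  B k d (f - h * m) /\ if (l <= k)%N && (e <= d)%N then U (k - l)%N (d - e)%N h else h = 0].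

Lemma adjoin_module B l e m : rees_module B -> rees_module (adjoin B l e m).
Proof.
move=> mB; split=> [k d|k d f f' [h [Bf Uh]] [h' [Bf' Uh']]|l' e' k d a f Ua [h [Bf Uh]]].
- exists 0; rewrite mul0r subr0; split; first exact: (module0 mB _ _).
  by case: ifP => // _; apply: (module0 mU _ _).
- exists (h + h'); split.
    by rewrite mulrDl opprD addrACA; apply: (moduleD mB).
  case: ifP Uh Uh' => _; first exact: (moduleD mU).
  by move=> -> ->; rewrite addr0.
- exists (a * h); split.
    by rewrite -mulrA -mulrBr; apply: (moduleM mB).
  case: ifP Uh => [/andP[lk ed] Uh|_ ->].
    rewrite !(leq_trans _ (leq_addl _ _)) //= -!addnBA //.
    exact: (moduleM mU).
  by rewrite mulr0; case: ifP => // _; apply: (module0 mU _ _).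
Qed.

Lemma sub_adjoin B l e m : subfamily B (adjoin B l e m).
Proof.
move=> k d f Bf; exists 0; rewrite mul0r subr0; split=> //.
by case: ifP => // _; apply: (module0 mU _ _).
Qed.

Lemma mem_adjoin B l e m : rees_module B -> adjoin B l e m l e m.
Proof.
move=> mB; exists 1; rewrite mul1r subrr; split; first exact: (module0 mB _ _).
by rewrite !leqnn !subnn; apply: (rees_family0 filtI (grading_one gradG)).
Qed.

Lemma adjoin_sub A B l e m : rees_module A -> subfamily B A -> A l e m ->
  subfamily (adjoin B l e m) A.
Proof.
move=> mA BA Am k d f [h [/BA Bf Uh]]; rewrite -(subrK (h * m) f).
apply: (moduleD mA Bf _); case: ifP Uh => [/andP[lk ed] Uh|_ ->].
  by rewrite -(subnK lk) -(subnK ed); apply: (moduleM mA Uh Am).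
by rewrite mul0r; apply: (module0 mA _ _).
Qed.

(** The annihilator of the class of [m], of bidegree [(l, e)], modulo [B] is a
bigraded prime ideal of the Rees algebra. *)
Definition prime_annihilator B l e m : Prop := ~ B l e m /\
  forall k d h k' d' h', U k d h -> U k' d' h' ->
    B (k + k' + l)%N (d + d' + e)%N (h * h' * m) ->
    B (k + l)%N (d + e)%N (h * m) \/ B (k' + l)%N (d' + e)%N (h' * m).

(** Noetherian induction: for a maximal counterexample [B], any bihomogeneous
[m] outside [B] with a maximal annihilator modulo [B] has a prime annihilator,
and adjoining it to [B] gives a larger module. *)
Lemma devissage A (Phi : bifamily -> Prop) : rees_module A -> noetherian A ->
  (forall B, rees_module B -> subfamily B A -> subfamily A B -> Phi B) ->
  (forall B l e m, rees_module B -> subfamily B A -> A l e m ->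
     prime_annihilator B l e m -> Phi (adjoin B l e m) -> Phi B) ->
  forall B, rees_module B -> subfamily B A -> Phi B.
Proof.
move=> mA nA base step B0 mB0 B0A; apply: contrapT => nPhi.
have [B [mB BA nB] Bmax] := noetherian_max (S := [set B | [/\ rees_module B,
    subfamily B A & ~ Phi B]]) nA (fun C h => let: And3 a b _ := h in conj a b)
    (ex_intro _ B0 (And3 mB0 B0A nPhi)).
pose ann l e m : bifamily := fun k d => [set h | U k d h /\ B (k + l)%N (d + e)%N (h * m)].
have [] := noetherian_max (S := [set C | exists l e m,
    [/\ A l e m, ~ B l e m & C = ann l e m]]) nU.
- move=> _ [l [e [m [Am _ ->]]]]; split; last by move=> k d h [].
  split=> [k d|k d f g [Uf Bf] [Ug Bg]|l' e' k d a f Ua [Uf Bf]].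
  + by split; [apply: (module0 mU _ _)|rewrite mul0r; apply: (module0 mB _ _)].
  + split; first exact: (moduleD mU Uf Ug).
    by rewrite mulrDl; apply: (moduleD mB Bf Bg).
  + split; first exact: (moduleM mU Ua Uf).
    by rewrite -mulrA -!addnA; apply: (moduleM mB Ua Bf).
- apply: contrapT => h; apply: nB; apply: base => // k d f Af.
  by apply: contrapT => nBf; apply: h; exists (ann k d f), k, d, f.
move=> _ [l [e [m [Am nBm ->]]]] annmax; apply: nB.
apply: (step B l e m) => //.
  split=> // k d h k' d' h' Uh Uh' Bhh'.
  have [|nBh'] := pselect (B (k' + l)%N (d' + e)%N (h' * m)); [by right|left].
  suff [] : ann l e m k d h by [].
  apply: (annmax (ann (k' + l)%N (d' + e)%N (h' * m)) _ _ k d).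
  - exists (k' + l)%N, (d' + e)%N, (h' * m); split=> //.
    exact: (moduleM mA Uh' Am).
  - move=> i j g [Ug Bg]; split=> //.
    have := moduleM mB Uh' Bg.
    by rewrite mulrCA [(k' + _)%N]addnCA [(d' + _)%N]addnCA.
  - by split=> //; rewrite !addnA mulrA.
apply: contrapT => nPhi'.
apply: nBm; apply: (Bmax (adjoin B l e m) _ _ l e); last exact: mem_adjoin.
  by split=> //; [apply: adjoin_module|apply: adjoin_sub].
exact: sub_adjoin.
Qed.

(** * Initial degrees of graded modules *)

(** The quotient of the Rees algebra by the annihilator [p] of the class of
[m]. The steps of the recursion are the bidegrees of those generators of the
ideal of elements of positive index that lie outside [p]. *)
Lemma quasi_arith_prime B l e m : rees_module B -> prime_annihilator B l e m ->
  quasi_arith (fun k => [set d | exists2 h, U k d h & ~ B (k + l)%N (d + e)%N (h * m)]).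
Proof.
move=> mB [nBm pB].
pose Upos : bifamily := fun k d => [set f | U k d f /\ (k = 0%N -> f = 0)].
have [||s [sU gen]] := nU (C := Upos).
- split=> [k d|k d f g [Uf f0] [Ug g0]|l' e' k d a f Ua [Uf f0]].
  + by split=> //; apply: (module0 mU _ _).
  + split=> [|k0]; first exact: (moduleD mU Uf Ug).
    by rewrite f0 ?g0 ?addr0.
  + split=> [|/eqP]; first exact: (moduleM mU Ua Uf).
    by rewrite addn_eq0 => /andP[_ /eqP/f0 ->]; rewrite mulr0.
- by move=> k d f [].
apply: (@quasi_arith_knapsack _ s (fun t => t.1.1) (fun t => t.1.2)
  [set t | ~ B (t.1.1 + l)%N (t.1.2 + e)%N (t.2 * m)]).
- move=> t /sU[_ t0] nB; rewrite lt0n; apply/eqP => /t0 tE; apply: nB.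
  by rewrite tE mul0r; apply: (module0 mB _ _).
- move=> t k d /sU[Ut _] nBt [h Uh nBh]; exists (t.2 * h).
    exact: (moduleM mU Ut Uh).
  by move=> /(pB _ _ _ _ _ _ Ut Uh)[].
move=> k d k0 [h Uh nBh].
(* The f that lie in p, or whose bidegree is that of a generator outside p plus
   that of another element outside p; primality makes this a module. *)
pose D : bifamily := fun k d => [set f | U k d f /\ (B (k + l)%N (d + e)%N (f * m) \/
  exists t, [/\ t \in s, ~ B (t.1.1 + l)%N (t.1.2 + e)%N (t.2 * m) &
  exists k' d' h', [/\ k = (t.1.1 + k')%N, d = (t.1.2 + d')%N, U k' d' h' &
    ~ B (k' + l)%N (d' + e)%N (h' * m)]])].
have mD : rees_module D.
  split=> [i j|i j f g [Uf Df] [Ug Dg]|i' j' i j a f Ua [Uf Df]].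
  - split; first exact: (module0 mU _ _).
    by left; rewrite mul0r; apply: (module0 mB _ _).
  - split; first exact: (moduleD mU Uf Ug).
    case: Df => [Bf|]; last by right.
    case: Dg => [Bg|]; last by right.
    by left; rewrite mulrDl; apply: (moduleD mB Bf Bg).
  - split; first exact: (moduleM mU Ua Uf).
    have Baf h' i1 j1 : B (i1 + l)%N (j1 + e)%N (h' * m) ->
        B (i' + i1 + l)%N (j' + j1 + e)%N (a * h' * m).
      by move=> Bh'; rewrite -mulrA -!addnA; apply: (moduleM mB Ua Bh').
    case: Df => [Bf|[t [ts nBt [k' [d' [h' [iE jE Uh' nBh']]]]]]].
      by left; apply: Baf.
    have [Ba|nBa] := pselect (B (i' + l)%N (j' + e)%N (a * m)).
      left; have := moduleM mB Uf Ba.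
      by congr (B _ _ _); [lia|lia|ring].
    right; exists t; split=> //; exists (i' + k')%N, (j' + d')%N, (a * h').
    split; [by rewrite iE addnCA|by rewrite jE addnCA|exact: (moduleM mU Ua Uh')|].
    by move=> /(pB _ _ _ _ _ _ Ua Uh')[].
have [||_ [|[t [ts nBt [k' [d' [h' [-> -> Uh' nBh']]]]]]]] // := gen D mD _ k d h.
- move=> t ts; have [Ut _] := sU t ts; split=> //.
  have [|nBt] := pselect (B (t.1.1 + l)%N (t.1.2 + e)%N (t.2 * m)); [by left|right].
  exists t; split=> //; exists 0%N, 0%N, 1; rewrite !addn0 !add0n mul1r; split=> //.
  exact: (rees_family0 filtI (grading_one gradG)).
- by split=> // kE; rewrite kE in k0.
by exists t; split=> //; exists k', d'; split=> //; exists h'.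
Qed.

(** Each step of the filtration contributes the initial degree of a quotient by
a prime, shifted by the bidegree of the adjoined element. *)
Lemma quasi_arith_subquotient A B : rees_module A -> noetherian A ->
  rees_module B -> subfamily B A ->
  quasi_arith (fun k => [set d | exists2 f, A k d f & ~ B k d f]).
Proof.
move=> mA nA; move: B; apply: devissage => // B.
  move=> mB BA AB; rewrite (_ : (fun _ => _) = fun=> set0); first exact: quasi_arith_empty.
  by apply/funext => k; apply/seteqP; split=> d // [f /AB].
move=> l e m mB BA Am pB IH.
have h : quasi_arith (fun k => [set d | exists2 f, adjoin B l e m k d f & ~ B k d f]).
  apply: (quasi_arith_shift (l := l) (e := e) (quasi_arith_prime mB pB)) => k d.
  split=> [[f [h [Bf Uh]] nBf]|[d' [h Uh nBh] ->]].
    move: Uh; rewrite leq_addr /=; case: ifP => [ed|_ h0]; last first.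
      by case: nBf; move: Bf; rewrite h0 mul0r subr0.
    rewrite addKn => Uh; exists (d - e)%N; last by rewrite subnKC.
    exists h => //; rewrite addnC subnK // => Bh; apply: nBf.
    by rewrite -(subrK (h * m) f); apply: (moduleD mB Bf Bh).
  exists (h * m); last by rewrite addnC [(e + _)%N]addnC.
  by exists h; rewrite subrr !leq_addr !addKn; split=> //; apply: (module0 mB _ _).
have := quasi_arith_union IH h; congr quasi_arith.
apply/funext => k; apply/seteqP; split=> d.
  move=> [[f Af nBf]|[f Bf nBf]]; exists f => //.
    by move=> Bf; apply/nBf/sub_adjoin.
  exact: (adjoin_sub mA BA Am).
move=> [f Af nBf].
have [Bf|nBf'] := pselect (adjoin B l e m k d f); first by right; exists f.
by left; exists f.
Qed.

(** * Finiteness of the set of associated primes *)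

(** The primes of [R] that are annihilators of a bihomogeneous element of
[A / B]. The annihilator is tested on homogeneous components, as [B] only knows
bihomogeneous elements. *)
Definition associated A B : set (set R) := [set P | prime_ideal P /\
  exists k d f, A k d f /\ forall r, P r <-> forall e, B k (e + d)%N (hcomp r e * f)].

(** Adjoining [m] to [B] loses at most one prime. Let [P] be the annihilator of
the class of [f] modulo [B]. If a homogeneous multiple [r * f] outside [B] lies
in the enlarged module, then [r * f] is congruent to a multiple [h * m], with
[h] outside the prime annihilator of [m]; so [P], which is also the annihilator
of [r * f], is the trace on [R] of that of [m]. Otherwise [P] is still the
annihilator of [f] modulo the enlarged module. *)
Lemma finite_associated A B : rees_module A -> noetherian A ->
  rees_module B -> subfamily B A -> finite_set (associated A B).
Proof.
move=> mA nA; move: B; apply: devissage => // B.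
  move=> mB BA AB; rewrite (_ : associated A B = set0) //.
  apply/seteqP; split=> // P [pP [k [d [f [Af PE]]]]].
  apply: (prime_ideal1 pP); apply/PE => e; apply: AB.
  by apply: (module_homogM filtI mA); first exact: hcompG.
move=> l e m mB BA Am [nBm pB] IH.
pose P0 := [set q | forall i, B l (i + e)%N (hcomp q i * m)].
apply: (@sub_finite_set _ _ (associated A (adjoin B l e m) `|` [set P0])); last first.
  by rewrite finite_setU; split=> //; apply: finite_set1.
move=> P [pP [k [d [f [Af PE]]]]].
have [[i [r [Gr [h [Bf Uh]] nBf]]]|h] := pselect (exists i r, [/\ G i r,
    adjoin B l e m k (i + d)%N (r * f) & ~ B k (i + d)%N (r * f)]); last first.
  left; split=> //; exists k, d, f; split=> // r; rewrite PE; split=> rf i.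
    exact: sub_adjoin.
  by apply: contrapT => nB; apply: h; exists i, (hcomp r i); split=> //; apply: hcompG.
right; case: ifP Uh => [/andP[lk ed] Uh|_ h0]; last first.
  by case: nBf; move: Bf; rewrite h0 mul0r subr0.
have rhB j a : G j a -> B k (j + (i + d))%N (a * (r * f)) <->
    B k (j + (i + d))%N (a * (h * m)).
  move=> Ga; have := module_homogM filtI mB Ga Bf; rewrite mulrBr => Baf; split=> Ba.
    by rewrite -[_ * _](subKr (a * (r * f))); apply: (moduleB gradG filtI mB).
  by rewrite -(subrK (a * (h * m)) (_ * (r * f))); apply: (moduleD mB Baf Ba).
have nBh : ~ B (k - l + l)%N (i + d - e + e)%N (h * m).
  rewrite !subnK // => Bh; apply: nBf; rewrite -(subrK (h * m) (r * f)).
  exact: (moduleD mB Bf Bh).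
have nPr : ~ P r by move=> /PE /(_ i); rewrite hcomp_id.
apply/seteqP; split=> q.
  move=> /PE Pq j; have Gq := hcompG gradG q j.
  have := module_homogM filtI mB Gr (Pq j).
  rewrite addnCA mulrCA => /(rhB _ _ Gq); rewrite mulrA => Bqh.
  have [||/nBh] // := pB _ _ _ _ _ _ (rees_family0 filtI Gq) Uh.
  by move: Bqh; congr (B _ _ _); lia.
move=> P0q; apply/PE => j; have Gq := hcompG gradG q j.
have : P (hcomp q j * r).
  apply/PE => n; rewrite (hcomp_homog gradG _ (grading_mul gradG Gq Gr)).
  case: eqP => [->|_]; last by rewrite mul0r; apply: (module0 mB _ _).
  rewrite -mulrA -addnA; apply/(rhB _ _ Gq); rewrite mulrCA.
  by have := moduleM mB Uh (P0q j); congr (B _ _ _); lia.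
by case/(prime_idealM pP) => [/PE/(_ j)|//]; rewrite hcomp_id.
Qed.

End Devissage.

(** * The v-number of a Noetherian filtration *)

Section VNumber.
Variables (R : comNzRingType) (G : nat -> set R) (I : nat -> set R).
Hypotheses (gradG : grading G) (filtI : graded_filtration G I).
Hypothesis noethI : noetherian_filtration I.

Let idealI k : ideal (I k).
Proof. by have [] := filtration_homogeneous filtI k. Qed.

(** The homogeneous [f] with [colon (I k) f = P] are those of [A] outside [B],
where [A] is the sum of the [(I_k : P)] and [B] the part of [A] that vanishes
in the localization at [P] of the quotient by [I_k]. *)
Lemma quasi_arith_colon_eq x e P : GRing.lreg x -> G e x -> prime_ideal P -> P x ->
  quasi_arith (fun k => [set d | exists2 f, G d f & colon (I k) f = P]).
Proof.
move=> xreg Gx pP Px.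
pose A k d := [set f | G d f /\ forall r, P r -> I k (r * f)].
pose B k d := [set f | A k d f /\ exists2 s, ~ P s & I k (s * f)].
have mA : rees_module G I A.
  split=> [k d|k d f g [Gf Pf] [Gg Pg]|l j k d a f [Ia Ga] [Gf Pf]].
  - by split=> [|r Pr]; rewrite ?mulr0; [apply: homog0|apply: ideal0].
  - split=> [|r Pr]; first exact: homogD.
    by rewrite mulrDr; apply: idealD; [|apply: Pf|apply: Pg].
  - split=> [|r Pr]; first exact: (grading_mul gradG).
    by rewrite mulrCA; apply: (filtrationM filtI) => //; apply: Pf.
have nA : noetherian G I A.
  apply: (noetherian_mul gradG filtI noethI (e := e) xreg) => k d f [Gf Pf].
  by split; [apply: Pf|rewrite addnC; apply: (grading_mul gradG)].
have mB : rees_module G I B.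
  split=> [k d|k d f g [Af [s nPs Is]] [Ag [t nPt It]]|l j k d a f Ua [Af [s nPs Is]]].
  - split; first exact: (module0 mA).
    by exists 1; [apply: prime_ideal1|rewrite mulr0; apply: ideal0].
  - split; first exact: (moduleD mA Af Ag).
    exists (s * t); first by case/(prime_idealM pP).
    rewrite mulrDr; apply: idealD => //; last by rewrite -mulrA; apply: idealM.
    by rewrite mulrAC mulrC; apply: idealM.
  - split; first exact: (moduleM mA Ua Af).
    by exists s => //; rewrite mulrCA; apply: (filtrationM filtI) => //; case: Ua.
have := quasi_arith_subquotient gradG filtI noethI mA nA mB (fun k d f => @proj1 _ _).
congr quasi_arith; apply/funext => k; apply/seteqP; split=> d [f].
  move=> [Gf Pf] nBf; exists f => //; apply/seteqP; split=> r //=; last exact: Pf.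
  by move=> Ir; apply: contrapT => nPr; apply: nBf; split=> //; exists r.
move=> Gf fP; have Pf r : P r -> I k (r * f) by rewrite -fP.
by exists f => // -[_ [s + Is]]; rewrite -fP; apply.
Qed.

(** Every prime [colon (I k) f] contains [x], because [x ^+ k] lies in [I k]; so
it is associated to the quotient of the sum [N] of the [(I_k : x)] by the Rees
algebra, and there are finitely many of these. *)
Lemma quasi_arith_colon_prime x e : GRing.lreg x -> G e x -> I 1%N x ->
  quasi_arith (fun k => [set d | exists2 f, G d f & prime_ideal (colon (I k) f)]).
Proof.
move=> xreg Gx Ix.
have xk k : I k (x ^+ k).
  elim: k => [|k IH]; first by rewrite (filtration0 filtI).
  by rewrite exprS; apply: (filtrationM filtI (k := 1%N)).
have Px k f P : prime_ideal P -> colon (I k) f = P -> P x.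
  move=> pP fP; apply: (prime_idealX (n := k) pP); rewrite -fP /colon /= mulrC.
  exact: idealM.
pose N : bifamily R := fun k d => [set f | G d f /\ I k (x * f)].
have mN : rees_module G I N.
  split=> [k d|k d f g [Gf If] [Gg Ig]|l j k d a f [Ia Ga] [Gf If]].
  - by split; rewrite ?mulr0; [apply: homog0|apply: ideal0].
  - by split; [apply: homogD|rewrite mulrDr; apply: idealD].
  - split; first exact: (grading_mul gradG).
    by rewrite mulrCA; apply: (filtrationM filtI).
have nN : noetherian G I N.
  apply: (noetherian_mul gradG filtI noethI (e := e) xreg) => k d f [Gf If].
  by split=> //; rewrite addnC; apply: (grading_mul gradG).
have UN : subfamily (rees_family G I) N.
  by move=> k d f [If Gf]; split=> //; apply: idealM.
have mU := rees_family_module gradG filtI.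
have [s sE] := (finite_seqP _).1 (finite_associated gradG filtI noethI mN nN mU UN).
have quasiP P : P \in s ->
    quasi_arith (fun k => [set d | exists2 f, G d f & colon (I k) f = P /\ prime_ideal P]).
  move=> Ps; have [pP _] : associated gradG N (rees_family G I) P by rewrite sE.
  have [PxP|nPx] := pselect (P x).
    have := quasi_arith_colon_eq xreg Gx pP PxP; congr quasi_arith.
    by apply/funext => k; apply/seteqP; split=> d [f Gf]; [|move=> []]; exists f.
  rewrite (_ : (fun _ => _) = fun=> set0); first exact: quasi_arith_empty.
  by apply/funext => k; apply/seteqP; split=> d // [f _ [/(Px _ _ _ pP)]].
have := quasi_arith_bigcup quasiP; congr quasi_arith.
apply/funext => k; apply/seteqP; split=> d.
  by move=> [P _ [f Gf [<- pP]]]; exists f.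
move=> [f Gf pP]; exists (colon (I k) f); last by exists f.
suff : associated gradG N (rees_family G I) (colon (I k) f) by rewrite sE.
have Pfx : colon (I k) f x by apply: (Px k f).
split=> //; exists k, d, f; split; first by split.
move=> r; split=> [Ir j|h].
  split; last by apply: (grading_mul gradG) => //; apply: hcompG.
  rewrite -(hcompMr gradG _ _ Gf).
  exact: homogeneous_hcomp (filtration_homogeneous filtI k) Ir.
have [n /(_ n (leqnn n)) rE] := hcompE gradG r.
rewrite /colon /= rE mulr_suml; apply: ideal_sum => // j _.
by have [] := h j.
Qed.

End VNumber.

Local Close Scope ring_scope.

Theorem theorem1p3 (R : idomainType) (G : nat -> set R)
    (gradG : grading G) (fieldG0 : is_subfield (G 0))
    (infG0 : infinite_set (G 0)) (fgR : fg_algebra_over (G 0))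
    (I : nat -> set R) (filtI : graded_filtration G I)
    (noethI : noetherian_filtration I) :
  eventually_quasi_linear (fun k : nat => v_number G (I k)).
Proof.
have vE k := v_numberE gradG (filtration_homogeneous filtI k).
apply: quasi_arith_eventually_quasi_linear vE.
have [[x [e [x0 Gx Ix]]]|I1] := pselect (exists x e, [/\ x != 0%R, G e x & I 1 x]).
  exact: (quasi_arith_colon_prime gradG filtI noethI (mulfI x0) Gx Ix).
have I1E k : I k.+1 = [set 0%R].
  have I0 j : I j 0%R by apply: ideal0; have [] := filtration_homogeneous filtI j.
  apply/seteqP; split=> [x|_ ->] //; elim: k => [|k IH]; last first.
    by move=> /(filtrationS filtI).
  move=> Ix /=; have [n /(_ n (leqnn n)) ->] := hcompE gradG x.
  rewrite big1 // => d _; apply: contrapT => /eqP h; apply: I1.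
  exists (hcomp gradG x d), d; split=> //; first exact: hcompG.
  exact: homogeneous_hcomp (filtration_homogeneous filtI 1) Ix.
pose L k := [set d | exists2 f, G d f & prime_ideal (colon (I k) f)].
exists 1%N => // k.
have LE j : L (k + 1 * (1 + j))%N = L 1%N.
  have -> : (k + 1 * (1 + j) = (k + j).+1)%N by lia.
  by rewrite /L !I1E.
exists 1%N; have [[d Ld]|h] := pselect (exists d, L 1%N d).
  have [n nP] := is_least_exists Ld; right; exists n, 0%N => j.
  by rewrite mul0n addn0 -/(L _) LE.
by left=> j; rewrite -/(L _) LE; apply/seteqP; split=> d // Ld; apply: h; exists d.
Qed.
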